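(* Let $E$ be an almost product structure on a finite-dimensional $3$-Lie algebra $(\mathfrak g,[\cdot,\cdot,\cdot]_{\mathfrak g})$ over $\mathbb R$ or $\mathbb C$. Then $E$ is a strong abelian product structure on $\mathfrak g$ if and only if $E$ is an $\mathcal O$-operator associated to the adjoint representation $(\mathfrak g,\mathrm{ad})$. Furthermore, in this case there exists a compatible $3$-pre-Lie algebra structure on the $3$-Lie algebra $\mathfrak g$, given by $\{x,y,z\}=E[x,y,Ez]_{\mathfrak g}$ for all $x,y,z\in\mathfrak g$.
   Context: A $3$-Lie algebra is a vector space $\mathfrak g$ with a trilinear skew-symmetric bracket $[\cdot,\cdot,\cdot]_{\mathfrak g}$ satisfying $[x,y,[z,w,v]]=[[x,y,z],w,v]+[z,[x,y,w],v]+[z,w,[x,y,v]]$. The adjoint representation is $\mathrm{ad}_{x,y}z=[x,y,z]_{\mathfrak g}$. An almost product structure on $\mathfrak g$ is a linear map $E:\mathfrak g\to\mathfrak g$ with $E^2=\mathrm{Id}$ and $E\neq\pm\mathrm{Id}$. It is a strong abelian product structure if $[x,y,z]_{\mathfrak g}=E[Ex,y,z]_{\mathfrak g}+E[x,Ey,z]_{\mathfrak g}+E[x,y,Ez]_{\mathfrak g}$ for all $x,y,z\in\mathfrak g$. A linear map $T:\mathfrak g\to\mathfrak g$ is an $\mathcal O$-operator associated to the adjoint representation if $[Tu,Tv,Tw]_{\mathfrak g}=T(\mathrm{ad}_{Tu,Tv}w+\mathrm{ad}_{Tv,Tw}u+\mathrm{ad}_{Tw,Tu}v)$ for all $u,v,w\in\mathfrak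 g$. A $3$-pre-Lie algebra is a vector space $A$ with a trilinear map $\{\cdot,\cdot,\cdot\}$ such that, with $[x,y,z]_C:=\{x,y,z\}+\{y,z,x\}+\{z,x,y\}$: (1) $\{x,y,z\}=-\{y,x,z\}$; (2) $\{x_1,x_2,\{x_3,x_4,x_5\}\}=\{[x_1,x_2,x_3]_C,x_4,x_5\}+\{x_3,[x_1,x_2,x_4]_C,x_5\}+\{x_3,x_4,\{x_1,x_2,x_5\}\}$; (3) $\{[x_1,x_2,x_3]_C,x_4,x_5\}=\{x_1,x_2,\{x_3,x_4,x_5\}\}+\{x_2,x_3,\{x_1,x_4,x_5\}\}+\{x_3,x_1,\{x_2,x_4,x_5\}\}$. It is compatible with a $3$-Lie bracket $[\cdot,\cdot,\cdot]_{\mathfrak g}$ on the same space if $[\cdot,\cdot,\cdot]_C=[\cdot,\cdot,\cdot]_{\mathfrak g}$. *)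

(* Defs.v *)
From HB Require Import structures.
From mathcomp Require Import all_boot all_order all_algebra.
From mathcomp Require Import reals.
From mathcomp.real_closed Require Import complex.

Set Implicit Arguments.
Unset Strict Implicit.
Unset Printing Implicit Defensive.

Import GRing.Theory.
Local Open Scope ring_scope.

Variant base_field := RealBase | ComplexBase.

Definition scalars (R : realType) (k : base_field) : fieldType :=
  match k with
  | RealBase => R
  | ComplexBase => R[i]
  end.

Definition trilinear (K : fieldType) (V : lmodType K)
    (b : V -> V -> V -> V) : Prop :=
  [/\ forall y z, linear (fun x => b x y z),
      forall x z, linear (fun y => b x y z)
    & forall x y, linear (fun z => b x y z)].

(* The two adjacent transpositions generate the symmetric group S_3. *)
Definition skew_symmetric3 (K : fieldType) (V : lmodType K)
    (b : V -> V -> V -> V) : Prop :=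
  (forall x y z, b x y z = - b y x z) /\ (forall x y z, b x y z = - b x z y).

Record threeLie (K : fieldType) (V : lmodType K) := ThreeLie {
  bracket :> V -> V -> V -> V;
  bracket_trilinear : trilinear bracket;
  bracket_skew : skew_symmetric3 bracket;
  bracket_fundamental : forall x y z w v,
    bracket x y (bracket z w v) =
      bracket (bracket x y z) w v + bracket z (bracket x y w) v
      + bracket z w (bracket x y v)
}.

Definition ad (K : fieldType) (V : lmodType K) (L : threeLie V)
    (x y : V) : V -> V := fun z => L x y z.

Definition commutator3 (K : fieldType) (V : lmodType K)
    (p : V -> V -> V -> V) (x y z : V) : V :=
  p x y z + p y z x + p z x y.

Record threePreLie (K : fieldType) (V : lmodType K) := ThreePreLie {
  preprod :> V -> V -> V -> V;
  preprod_trilinear : trilinear preprod;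
  preprod_skew : forall x y z, preprod x y z = - preprod y x z;
  preprod_deriv : forall x1 x2 x3 x4 x5,
    preprod x1 x2 (preprod x3 x4 x5) =
      preprod (commutator3 preprod x1 x2 x3) x4 x5
      + preprod x3 (commutator3 preprod x1 x2 x4) x5
      + preprod x3 x4 (preprod x1 x2 x5);
  preprod_comm : forall x1 x2 x3 x4 x5,
    preprod (commutator3 preprod x1 x2 x3) x4 x5 =
      preprod x1 x2 (preprod x3 x4 x5)
      + preprod x2 x3 (preprod x1 x4 x5)
      + preprod x3 x1 (preprod x2 x4 x5)
}.

Definition compatible (K : fieldType) (V : lmodType K)
    (P : threePreLie V) (L : threeLie V) : Prop :=
  forall x y z, commutator3 P x y z = L x y z.

Definition almost_product (K : fieldType) (g : vectType K)
    (E : 'End(g)) : Prop :=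
  [/\ (E \o E)%VF = \1%VF, E <> \1%VF & E <> - \1%VF].

Definition strong_abelian_product (K : fieldType) (g : vectType K)
    (L : threeLie g) (E : 'End(g)) : Prop :=
  almost_product E /\
  forall x y z,
    L x y z = E (L (E x) y z) + E (L x (E y) z) + E (L x y (E z)).

Definition O_operator_ad (K : fieldType) (g : vectType K)
    (L : threeLie g) (T : 'End(g)) : Prop :=
  forall u v w,
    L (T u) (T v) (T w) =
      T (ad L (T u) (T v) w + ad L (T v) (T w) u + ad L (T w) (T u) v).

(* Main.v *)
Require Import Defs.
From HB Require Import structures.
From mathcomp Require Import all_boot all_order all_algebra.
From mathcomp Require Import reals.
From mathcomp.real_closed Require Import complex.

(** Both claims come from [E] being an involution.  The strong abelian identity
    at [(E u, E v, E w)] reads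
      [[E u, E v, E w] = E [u, E v, E w] + E [E u, v, E w] + E [E u, E v, w]],
    which is the O-operator identity at [(u, v, w)] after cyclic rotations of
    the brackets; as [E] is bijective, the two conditions are equivalent
    ([strong_abelian_iff_O_operator]).

    For the product [{x, y, z} = E [x, y, E z]], the strong abelian identity says
    precisely that its commutator is the given bracket, again up to rotation.
    In a nested product the two inner copies of [E] cancel:
      [{a, b, {c, d, z}} = E [a, b, [c, d, E z]]].
    The two remaining axioms are therefore [E] applied to identities of
    the 3-Lie algebra with last argument [E z]: the fundamental identity itself,
    and its rotated form [bracket_fundamental_cyclic]. *)

Set Implicit Arguments.
Unset Strict Implicit.
Unset Printing Implicit Defensive.

Import GRing.Theory.
Local Open Scope ring_scope.

Section ThreeLieIdentities.

Variables (K : fieldType) (V : lmodType K) (L : threeLie V).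

Lemma bracket_cycle x y z : L x y z = L y z x.
Proof.
have [skew12 skew23] := bracket_skew L.
by rewrite skew12 skew23 opprK.
Qed.

(** Rotating [[[x1, x2, x3], x4, y]] to [[x4, y, [x1, x2, x3]]] lets [ad_{x4, y}]
    act as a derivation; rotating each resulting term puts the inner brackets
    in last position. *)
Lemma bracket_fundamental_cyclic x1 x2 x3 x4 y :
  L (L x1 x2 x3) x4 y =
    L x1 x2 (L x3 x4 y) + L x2 x3 (L x1 x4 y) + L x3 x1 (L x2 x4 y).
Proof.
rewrite bracket_cycle bracket_fundamental -!(bracket_cycle _ x4 y).
rewrite (bracket_cycle (L x1 x4 y)) -(bracket_cycle x3 x1).
by rewrite addrC addrA.
Qed.

End ThreeLieIdentities.

Section InvolutionProduct.

Variables (K : fieldType) (V : lmodType K) (L : threeLie V).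
Variable E : {linear V -> V}.

Definition twisted_product (x y z : V) : V := E (L x y (E z)).

Lemma twisted_product_trilinear : trilinear twisted_product.
Proof.
have [lin1 lin2 lin3] := bracket_trilinear L.
split=> u v a x y; rewrite /twisted_product.
- by rewrite lin1 linearP.
- by rewrite lin2 linearP.
- by rewrite linearP lin3 linearP.
Qed.

Lemma twisted_product_skew x y z :
  twisted_product x y z = - twisted_product y x z.
Proof.
have [skew12 _] := bracket_skew L.
by rewrite /twisted_product skew12 linearN.
Qed.

Hypothesis E_involutive : involutive E.

Lemma twisted_product_nested a b c d z :
  twisted_product a b (twisted_product c d z) = E (L a b (L c d (E z))).
Proof. by rewrite /twisted_product E_involutive. Qed.

Hypothesis E_strong : forall x y z,
  L x y z = E (L (E x) y z) + E (L x (E y) z) + E (L x y (E z)).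

Lemma commutator_twisted_product x y z :
  commutator3 twisted_product x y z = L x y z.
Proof.
rewrite E_strong /commutator3 /twisted_product.
by rewrite (bracket_cycle L (E x)) -(bracket_cycle L z x) [RHS]addrC addrA.
Qed.

Lemma twisted_product_deriv x1 x2 x3 x4 x5 :
  twisted_product x1 x2 (twisted_product x3 x4 x5) =
    twisted_product (commutator3 twisted_product x1 x2 x3) x4 x5
    + twisted_product x3 (commutator3 twisted_product x1 x2 x4) x5
    + twisted_product x3 x4 (twisted_product x1 x2 x5).
Proof.
rewrite !commutator_twisted_product !twisted_product_nested.
by rewrite bracket_fundamental !linearD.
Qed.

Lemma twisted_product_comm x1 x2 x3 x4 x5 :
  twisted_product (commutator3 twisted_product x1 x2 x3) x4 x5 =
    twisted_product x1 x2 (twisted_product x3 x4 x5)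
    + twisted_product x2 x3 (twisted_product x1 x4 x5)
    + twisted_product x3 x1 (twisted_product x2 x4 x5).
Proof.
rewrite commutator_twisted_product !twisted_product_nested -!linearD.
by rewrite -bracket_fundamental_cyclic.
Qed.

Definition twisted_threePreLie : threePreLie V :=
  ThreePreLie twisted_product_trilinear twisted_product_skew
    twisted_product_deriv twisted_product_comm.

End InvolutionProduct.

Section AlmostProduct.

Variables (K : fieldType) (g : vectType K) (L : threeLie g) (E : 'End(g)).
Hypothesis hE : almost_product E.

Lemma almost_product_involutive : involutive E.
Proof. by case: hE => EE _ _ x; rewrite -comp_lfunE EE id_lfunE. Qed.

Lemma strong_abelian_iff_O_operator :
  strong_abelian_product L E <-> O_operator_ad L E.
Proof.
have EK := almost_product_involutive.
have rotate a b c u v w :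
    E (L u b c) + E (L a v c) + E (L a b w) = E (L a b w + L b c u + L c a v).
  rewrite !linearD (bracket_cycle L u) -(bracket_cycle L c a).
  by rewrite [LHS]addrC addrA.
split=> [[_ E_strong] u v w | E_op].
  by rewrite E_strong !EK rotate.
split=> // x y z.
by have := E_op (E x) (E y) (E z); rewrite !EK /ad => ->; rewrite -rotate.
Qed.

End AlmostProduct.

Theorem proposition5p14 (R : realType) (k : base_field)
    (g : vectType (scalars R k)) (L : threeLie g) (E : 'End(g))
    (hE : almost_product E) :
  (strong_abelian_product L E <-> O_operator_ad L E) /\
  (strong_abelian_product L E ->
   exists P : threePreLie g,
     compatible P L /\ forall x y z : g, P x y z = E (L x y (E z))).
Proof.
split; first exact: strong_abelian_iff_O_operator.
move=> [_ E_strong].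
exists (twisted_threePreLie (almost_product_involutive hE) E_strong).
by split=> // x y z; apply: commutator_twisted_product.
Qed.
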